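(* Let $F$ be a topological space, let $(H,\mathcal{N},\circ,\bullet)$ be a neutrosophic metric space, and let $f_n:F\to H$ ($n\in\mathbb{N}$) be a sequence of continuous functions (with $H$ carrying the topology $\tau_{\mathcal{N}}$). If $(f_n)$ converges uniformly to $f:F\to H$, then $f$ is continuous.
   Context: A continuous t-norm is a continuous, commutative, associative operation $\circ:[0,1]\times[0,1]\to[0,1]$ with $s\circ 1=s$ for all $s$, and $s\circ t\le u\circ v$ whenever $s\le u$, $t\le v$. A continuous t-conorm is a continuous, commutative, associative operation $\bullet:[0,1]\times[0,1]\to[0,1]$ with $s\bullet 0=s$ for all $s$, and $s\bullet t\le u\bullet v$ whenever $s\le u$, $t\le v$. A neutrosophic metric space (NMS) is a four-tuple $(H,\mathcal{N},\circ,\bullet)$ where $H$ is a set, $\circ$ is a continuous t-norm, $\bullet$ is a continuous t-conorm, and $\mathcal{N}=(G,B,Y)$ consists of three functions $G,B,Y:H\times H\times(0,\infty)\to[0,1]$ such that for all $a,b,c\in H$ and all $\lambda,\mu>0$: (1) $G(a,b,\lambda)+B(a,b,\lambda)+Y(a,b,\lambda)\le 3$; (2) $G(a,b,\lambda)=1$ if and only if $a=b$; $B(a,b,\lambda)=0$ if and only if $a=b$; $Y(a,b,\lambda)=0$ if and only if $a=b$; (3) $G,B,Y$ are symmetric in their first two arguments; (4) $G(a,b,\lambda)\circ G(b,c,\mu)\le G(a,c,\lambda+\mu)$, $B(a,b,\lambda)\bullet B(b,c,\mu)\ge B(a,c,\lambda+\mu)$, $Y(a,b,\lambda)\bullet Y(b,c,\mu)\ge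 Y(a,c,\lambda+\mu)$; (5) $G(a,b,\cdot)$, $B(a,b,\cdot)$, $Y(a,b,\cdot)$ are continuous on $(0,\infty)$; (6) $\lim_{\lambda\to\infty}G(a,b,\lambda)=1$, $\lim_{\lambda\to\infty}B(a,b,\lambda)=0$, $\lim_{\lambda\to\infty}Y(a,b,\lambda)=0$. By convention, for $\lambda\le 0$ one sets $G(a,b,\lambda)=0$, $B(a,b,\lambda)=1$, $Y(a,b,\lambda)=1$. For $a\in H$, $0<\varepsilon<1$, $\lambda>0$, the open ball is $O(a,\varepsilon,\lambda)=\{b\in H: G(a,b,\lambda)>1-\varepsilon,\ B(a,b,\lambda)<\varepsilon,\ Y(a,b,\lambda)<\varepsilon\}$. The topology $\tau_{\mathcal{N}}$ on $H$ consists of all $A\subset H$ such that for each $a\in A$ there exist $\lambda>0$ and $\varepsilon\in(0,1)$ with $O(a,\varepsilon,\lambda)\subset A$. For a nonempty set $F$, a sequence of functions $f_n:F\to H$ converges uniformly to $f:F\to H$ if for every $\lambda>0$ and $\varepsilon\in(0,1)$ there exists $N\in\mathbb{N}$ such that $G(f_n(a),f(a),\lambda)>1-\varepsilon$, $B(f_n(a),f(a),\lambda)<\varepsilon$ and $Y(f_n(a),f(a),\lambda)<\varepsilon$ for all $n\ge N$ and all $a\in F$. *)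

(* Defs.v *)
From HB Require Import structures.
From mathcomp Require Import all_boot all_order all_algebra.
From mathcomp Require Import all_classical all_reals all_analysis.

Set Implicit Arguments.
Unset Strict Implicit.
Unset Printing Implicit Defensive.

Import Order.TTheory GRing.Theory Num.Theory.
Import numFieldNormedType.Exports.

Local Open Scope classical_set_scope.
Local Open Scope ring_scope.

(* An operation on [0,1] is a binary function on [R] that preserves [0,1];
   its values outside the unit square are irrelevant. *)
Record continuous_unit_op (R : realType) (e : R) (op : R -> R -> R) : Prop := {
  cuo_range : {in `[0, 1] &, forall s t, op s t \in `[0, 1]} ;
  cuo_continuous :
    {within `[0, 1] `*` `[0, 1], continuous (fun p : R * R => op p.1 p.2)} ;
  cuo_comm : {in `[0, 1] &, forall s t, op s t = op t s} ;
  cuo_assoc : {in `[0, 1] & &, forall s t u, op s (op t u) = op (op s t) u} ;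
  cuo_unit : {in `[0, 1], forall s, op s e = s} ;
  cuo_mono : forall s t u v : R,
    s \in `[0, 1] -> t \in `[0, 1] -> u \in `[0, 1] -> v \in `[0, 1] ->
    s <= u -> t <= v -> op s t <= op u v
}.

Definition continuous_tnorm (R : realType) (op : R -> R -> R) : Prop :=
  continuous_unit_op 1 op.

Definition continuous_tconorm (R : realType) (op : R -> R -> R) : Prop :=
  continuous_unit_op 0 op.

(* [G], [B] and [Y] are total in the real parameter; the fields [_le0] fix
   their values at nonpositive parameters. *)
Record NMS (R : realType) := {
  nms_set :> Type ;
  nms_G : nms_set -> nms_set -> R -> R ;
  nms_B : nms_set -> nms_set -> R -> R ;
  nms_Y : nms_set -> nms_set -> R -> R ;
  nms_tnorm : R -> R -> R ;
  nms_tconorm : R -> R -> R ;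
  nms_tnormP : continuous_tnorm nms_tnorm ;
  nms_tconormP : continuous_tconorm nms_tconorm ;
  nms_G_range : forall a b l, 0 < l -> nms_G a b l \in `[0, 1] ;
  nms_B_range : forall a b l, 0 < l -> nms_B a b l \in `[0, 1] ;
  nms_Y_range : forall a b l, 0 < l -> nms_Y a b l \in `[0, 1] ;
  nms_G_le0 : forall a b l, l <= 0 -> nms_G a b l = 0 ;
  nms_B_le0 : forall a b l, l <= 0 -> nms_B a b l = 1 ;
  nms_Y_le0 : forall a b l, l <= 0 -> nms_Y a b l = 1 ;
  nms_sum_le3 : forall a b l, 0 < l ->
    nms_G a b l + nms_B a b l + nms_Y a b l <= 3 ;
  nms_G_eq1 : forall a b l, 0 < l -> (nms_G a b l = 1 <-> a = b) ;
  nms_B_eq0 : forall a b l, 0 < l -> (nms_B a b l = 0 <-> a = b) ;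
  nms_Y_eq0 : forall a b l, 0 < l -> (nms_Y a b l = 0 <-> a = b) ;
  nms_G_sym : forall a b l, 0 < l -> nms_G a b l = nms_G b a l ;
  nms_B_sym : forall a b l, 0 < l -> nms_B a b l = nms_B b a l ;
  nms_Y_sym : forall a b l, 0 < l -> nms_Y a b l = nms_Y b a l ;
  nms_G_triangle : forall a b c l m, 0 < l -> 0 < m ->
    nms_tnorm (nms_G a b l) (nms_G b c m) <= nms_G a c (l + m) ;
  nms_B_triangle : forall a b c l m, 0 < l -> 0 < m ->
    nms_tconorm (nms_B a b l) (nms_B b c m) >= nms_B a c (l + m) ;
  nms_Y_triangle : forall a b c l m, 0 < l -> 0 < m ->
    nms_tconorm (nms_Y a b l) (nms_Y b c m) >= nms_Y a c (l + m) ;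
  nms_G_continuous : forall a b, {within `]0, +oo[, continuous (nms_G a b)} ;
  nms_B_continuous : forall a b, {within `]0, +oo[, continuous (nms_B a b)} ;
  nms_Y_continuous : forall a b, {within `]0, +oo[, continuous (nms_Y a b)} ;
  nms_G_lim : forall a b, nms_G a b l @[l --> +oo] --> (1 : R) ;
  nms_B_lim : forall a b, nms_B a b l @[l --> +oo] --> (0 : R) ;
  nms_Y_lim : forall a b, nms_Y a b l @[l --> +oo] --> (0 : R)
}.

Definition nms_ball (R : realType) (M : NMS R) (a : M) (eps l : R) : set M :=
  [set b | [/\ nms_G a b l > 1 - eps, nms_B a b l < eps & nms_Y a b l < eps]].

Definition nms_open (R : realType) (M : NMS R) : set (set M) :=
  [set A | forall a, A a -> exists l eps : R,
    [/\ 0 < l, 0 < eps < 1 & nms_ball a eps l `<=` A]].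
Arguments nms_open {R} M _.

Section topology.
Variables (R : realType) (M : NMS R).
Implicit Types (a b : M) (l m eps : R).

Lemma nms_G_nondecreasing a b l m :
  0 < l -> l <= m -> nms_G a b l <= nms_G a b m.
Proof.
move=> l0; rewrite le_eqVlt => /predU1P[->//|lm].
have ml : 0 < m - l by rewrite subr_gt0.
have := nms_G_triangle a b b l0 ml.
rewrite (nms_G_eq1 b b ml).2// (cuo_unit (nms_tnormP M)) ?nms_G_range//.
by rewrite addrC subrK.
Qed.

Lemma nms_B_nonincreasing a b l m :
  0 < l -> l <= m -> nms_B a b m <= nms_B a b l.
Proof.
move=> l0; rewrite le_eqVlt => /predU1P[->//|lm].
have ml : 0 < m - l by rewrite subr_gt0.
have := nms_B_triangle a b b l0 ml.
rewrite (nms_B_eq0 b b ml).2// (cuo_unit (nms_tconormP M)) ?nms_B_range//.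
by rewrite addrC subrK.
Qed.

Lemma nms_Y_nonincreasing a b l m :
  0 < l -> l <= m -> nms_Y a b m <= nms_Y a b l.
Proof.
move=> l0; rewrite le_eqVlt => /predU1P[->//|lm].
have ml : 0 < m - l by rewrite subr_gt0.
have := nms_Y_triangle a b b l0 ml.
rewrite (nms_Y_eq0 b b ml).2// (cuo_unit (nms_tconormP M)) ?nms_Y_range//.
by rewrite addrC subrK.
Qed.

Lemma sub_nms_ball a eps eps' l l' : 0 < l -> l <= l' -> eps <= eps' ->
  nms_ball a eps l `<=` nms_ball a eps' l'.
Proof.
move=> l0 ll' ee' b [Gb Bb Yb]; split.
- apply: lt_le_trans (nms_G_nondecreasing a b l0 ll').
  by apply: le_lt_trans Gb; rewrite lerB.
- exact: le_lt_trans (nms_B_nonincreasing a b l0 ll') (lt_le_trans Bb ee').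
- exact: le_lt_trans (nms_Y_nonincreasing a b l0 ll') (lt_le_trans Yb ee').
Qed.

Lemma nms_openT : nms_open M setT.
Proof.
move=> a _; exists 1, 2^-1; split => //.
by rewrite invr_gt0 ltr0n invf_lt1 ?ltr0n// ltr1n.
Qed.

Lemma nms_openI : setI_closed (nms_open M).
Proof.
move=> A B oA oB a [/oA[l [e [l0 /andP[e0 e1] sA]]]
                    /oB[m [d [m0 /andP[d0 d1] sB]]]].
exists (Num.min l m), (Num.min e d).
have lm0 : 0 < Num.min l m by rewrite lt_min l0.
split => //; first by rewrite lt_min e0 d0 gt_min e1.
rewrite subsetI; split.
- apply: subset_trans sA; apply: sub_nms_ball => //; by rewrite ge_min lexx.
- apply: subset_trans sB; apply: sub_nms_ball => //;
  by rewrite ge_min lexx orbT.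
Qed.

Lemma nms_open_bigU (I : Type) (A : I -> set M) :
  (forall i, nms_open M (A i)) -> nms_open M (\bigcup_i A i).
Proof.
move=> oA a [i _ /oA[l [e [l0 e01 sA]]]]; exists l, e; split => //.
by apply: subset_trans sA _ => b Ab; exists i.
Qed.

End topology.

HB.instance Definition _ (R : realType) (M : NMS R) :=
  gen_eqMixin (nms_set M).
HB.instance Definition _ (R : realType) (M : NMS R) :=
  gen_choiceMixin (nms_set M).
HB.instance Definition _ (R : realType) (M : NMS R) :=
  isOpenTopological.Build (nms_set M)
    (@nms_openT R M) (@nms_openI R M) (@nms_open_bigU R M).

Lemma nms_openE (R : realType) (M : NMS R) (A : set M) : open A = nms_open M A.
Proof. by []. Qed.

Definition nms_uniform_cvg (R : realType) (M : NMS R) (F : Type)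
    (f_ : nat -> F -> M) (f : F -> M) : Prop :=
  forall l eps : R, 0 < l -> 0 < eps < 1 ->
    exists N : nat, forall n : nat, (N <= n)%N -> forall a : F,
      [/\ nms_G (f_ n a) (f a) l > 1 - eps,
          nms_B (f_ n a) (f a) l < eps &
          nms_Y (f_ n a) (f a) l < eps].

(* Main.v *)
Require Import Defs.
From mathcomp Require Import all_boot all_order all_algebra.
From mathcomp Require Import all_classical all_reals all_analysis.
From mathcomp Require Import lra.

(** Continuity of the t-norm at [(1, 1)] and of the t-conorm at [(0, 0)] turn
    the triangle inequalities into an approximate one for balls: two
    [d]-steps of durations [l] and [m] make one [eps]-step of duration
    [l + m], with [d] depending only on [eps]. This makes balls neighbourhoods
    of their centers, and the classical three-step estimate through
    [f x, f_ n x, f_ n y, f y] concludes. *)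

Import Order.TTheory GRing.Theory Num.Theory.
Import numFieldNormedType.Exports.
Local Open Scope classical_set_scope.
Local Open Scope ring_scope.

(** Since [op e e = e], this is continuity at the corner [(e, e)]; balls of the product are
    componentwise, so a single [d] bounds both arguments. *)
Lemma unit_op_near_unit {R : realType} {e : R} {op : R -> R -> R} :
  continuous_unit_op e op -> e \in `[0, 1] -> forall eps : R, 0 < eps ->
  exists2 d, 0 < d & {in `[0, 1] &, forall s t,
    `|e - s| < d -> `|e - t| < d -> `|e - op s t| < eps}.
Proof.
move=> opP e01 eps eps0.
have /subspace_continuousP/(_ (e, e)) := cuo_continuous opP.
move=> /(_ (conj e01 e01)) /cvgr_dist_lt /(_ _ eps0).
rewrite near_withinE => /nbhs_ballP[d /= d0 dP].
exists d => // s t s01 t01 es et.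
by have := dP (s, t) (conj es et) (conj s01 t01);
  rewrite /from_subspace /= (cuo_unit opP e01).
Qed.

Section ball.
Context {R : realType} {M : NMS R}.
Implicit Types (a b c : M) (l m d eps : R).

Lemma nms_ball_center a eps l : 0 < l -> 0 < eps -> nms_ball a eps l a.
Proof.
move=> l0 e0; rewrite /nms_ball /=.
rewrite (nms_G_eq1 a a l0).2// (nms_B_eq0 a a l0).2// (nms_Y_eq0 a a l0).2//.
by rewrite ltrBlDr ltrDl.
Qed.

Lemma nms_ball_sym a b eps l : 0 < l -> nms_ball a eps l b -> nms_ball b eps l a.
Proof.
by move=> l0; rewrite /nms_ball /= (nms_G_sym a) // (nms_B_sym a) // (nms_Y_sym a).
Qed.

Lemma nms_ball_triangle eps : 0 < eps -> exists2 d, 0 < d < 1 &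
  forall a b c l m, 0 < l -> 0 < m ->
    nms_ball a d l b -> nms_ball b d m c -> nms_ball a eps (l + m) c.
Proof.
move=> e0.
have i1 : 1 \in `[0 : R, 1] by rewrite in_itv /= ler01 lexx.
have i0 : 0 \in `[0 : R, 1] by rewrite in_itv /= ler01 lexx.
have [d1 d10 d1P] := unit_op_near_unit (nms_tnormP M) i1 _ e0.
have [d2 d20 d2P] := unit_op_near_unit (nms_tconormP M) i0 _ e0.
have conormP s t : s \in `[0, 1] -> t \in `[0, 1] -> s < d2 -> t < d2 ->
    nms_tconorm M s t < eps.
  move=> s01 t01 sd td; have := d2P s t s01 t01.
  have [/andP[s0 _] /andP[t0 _]] := (s01, t01).
  rewrite !sub0r !normrN (ger0_norm s0) (ger0_norm t0) => /(_ sd td).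
  exact/le_lt_trans/ler_norm.
have normP s t : s \in `[0, 1] -> t \in `[0, 1] -> 1 - d1 < s -> 1 - d1 < t ->
    1 - eps < nms_tnorm M s t.
  move=> s01 t01 sd td; have := d1P s t s01 t01.
  have [/andP[_ s1] /andP[_ t1]] := (s01, t01).
  rewrite (@ger0_norm _ (1 - s)) ?(@ger0_norm _ (1 - t)) ?subr_ge0 //.
  rewrite ltrBlDr -ltrBlDl sd ltrBlDr -ltrBlDl td => /(_ isT isT).
  by move=> /(le_lt_trans (ler_norm _)); rewrite ltrBlDr -ltrBlDl.
(* [d1] serves [G], [d2] serves [B] and [Y], and [1 / 2] keeps the radius below 1. *)
exists (Num.min (1 / 2) (Num.min d1 d2)).
  by rewrite !lt_min d10 d20 !gt_min; apply/andP; split; lra.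
move=> a b c l m l0 m0.
set d := Num.min _ _.
have dd1 : d <= d1 by rewrite /d !ge_min lexx !orbT.
have dd2 : d <= d2 by rewrite /d !ge_min lexx !orbT.
have ltd1 x : 1 - d < x -> 1 - d1 < x by apply: le_lt_trans; rewrite lerB.
have ltd2 x : x < d -> x < d2 by move=> /lt_le_trans; apply.
move=> [/ltd1 G1 /ltd2 B1 /ltd2 Y1] [/ltd1 G2 /ltd2 B2 /ltd2 Y2]; split.
- exact: lt_le_trans (normP _ _ (nms_G_range _ _ l0) (nms_G_range _ _ m0) G1 G2)
    (nms_G_triangle _ _ _ l0 m0).
- exact: le_lt_trans (nms_B_triangle _ b _ l0 m0)
    (conormP _ _ (nms_B_range _ _ l0) (nms_B_range _ _ m0) B1 B2).
- exact: le_lt_trans (nms_Y_triangle _ b _ l0 m0)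
    (conormP _ _ (nms_Y_range _ _ l0) (nms_Y_range _ _ m0) Y1 Y2).
Qed.

Lemma nbhs_nms_ball a eps l : 0 < l -> 0 < eps < 1 -> nbhs a (nms_ball a eps l).
Proof.
move=> l0 e01; rewrite nbhsE /=.
(* the interior of the ball, open by the approximate triangle inequality *)
exists [set b | exists m d, [/\ 0 < m, 0 < d < 1 &
    nms_ball b d m `<=` nms_ball a eps l]]; last first.
  move=> b [m [d [m0 /andP[d0 _]]]]; apply; exact: nms_ball_center.
split; last by exists l, eps; split.
rewrite nms_openE => b [m [d [m0 /andP[d0 d1] sb]]].
have m20 : 0 < m / 2 by rewrite divr_gt0.
have [r r01 rP] := nms_ball_triangle _ d0.
(* Half of the duration leads from [b] to [c], the other half from [c] to [x]; thus [c] inherits a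
   ball of the same size inside the given one. *)
exists (m / 2), r; split => // c bc; exists (m / 2), r; split => // x cx.
by apply: sb; rewrite (splitr m); exact: rP bc cx.
Qed.

End ball.

Theorem theorem3p22 (R : realType) (F : topologicalType) (M : NMS R)
    (f_ : nat -> F -> M) (f : F -> M)
    (f_continuous : forall n : nat, continuous (f_ n))
    (f_f : nms_uniform_cvg f_ f) :
  continuous f.
Proof.
move=> x A; rewrite nbhsE => -[U [oU Ux] UA].
have [l [eps [l0 /andP[e0 _] lU]]] : exists l eps : R,
  [/\ 0 < l, 0 < eps < 1 & nms_ball (f x) eps l `<=` U] by exact: oU.
(* Three steps need two nested splittings: [r]-steps from [f x] to [f_ N x] to [f_ N y], each of
   duration [l / 4], make a [d]-step; a further [d]-step of duration [l / 2] reaches [f y]. *)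
have [d /andP[d0 d1] dP] := @nms_ball_triangle R M eps e0.
have [r /andP[r0 r1] rP] := @nms_ball_triangle R M d d0.
have s01 : 0 < Num.min d r < 1 by rewrite lt_min d0 r0 gt_min d1.
have l20 : 0 < l / 2 by rewrite divr_gt0.
have l40 : 0 < l / 2 / 2 by rewrite divr_gt0.
(* One index [N], taken for the smaller radius and the shorter duration, serves both uses of uniform
   convergence, as balls grow with either parameter. *)
have [N /(_ N (leqnn N)) fN] := f_f _ _ l40 s01.
have fNr y : nms_ball (f_ N y) r (l / 2 / 2) (f y).
  by apply: sub_nms_ball (fN y); rewrite // ge_min lexx orbT.
have fNd y : nms_ball (f_ N y) d (l / 2) (f y).
  by apply: sub_nms_ball (fN y); rewrite // ?ge_min ?lexx //; lra.
have r01 : 0 < r < 1 by rewrite r0.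
have fNx : \forall y \near x, nms_ball (f_ N x) r (l / 2 / 2) (f_ N y).
  exact: f_continuous N x _ (nbhs_nms_ball (f_ N x) _ _ l40 r01).
rewrite nbhs_simpl /=; apply: filterS fNx => y xy; apply/UA/lU; rewrite (splitr l).
apply: dP (fNd y) => //; rewrite (splitr (l / 2)).
(* Uniform convergence centers the ball at [f_ N x], whereas the first step starts from [f x]. *)
by apply: rP xy => //; exact: nms_ball_sym.
Qed.
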